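(* Let $G$ be a graph and let $c$ be a chip configuration on $G$ such that the chip-firing process beginning at $c$ terminates. Then the set of join-irreducible elements of the configuration poset of $c$, with the order induced from the configuration poset, is isomorphic as a poset to the move poset of $c$.
   Context: A chip configuration on a (simple, undirected) graph $G$ is a function from the vertices of $G$ to $\mathbb{N}=\{0,1,2,\dots\}$ giving the number of chips at each vertex. A vertex (also called a site) can fire in a configuration if it has at least as many chips as it has neighbors (in particular it has finitely many neighbors); firing it sends one chip from it to each of its neighbors. A firing sequence from a configuration is a finite sequence of successive legal firing moves; a configuration is reachable from another if it is obtained from it by a (possibly empty) firing sequence. The process beginning at $c$ terminates if some (equivalently, every maximal) sequence of legal firings from $c$ reaches, after finitely many moves, a configuration in which no vertex can fire. For a terminating process, every firing sequence from $c$ to completion fires each site $k$ the same number of times $N_k$. Configuration poset of $c$: its elements are all configurations reachable from $c$, with $c_1\ge c_2$ if and only if $c_2$ can be reached from $c_1$ by some (possibly empty) sequence of firing moves (so earlier configurations are larger). It is a finite lattice; a join-irreducible is an element that covers exactly one other element. Move poset of $c$: its elements are the symbols $k^j$ with $k$ a site and $1\le j\le N_k$, where $k^j$ stands for the $j$-th firing move at site $k$. The order is $k^j\ge k'^{j'}$ if and only if move $k^j$ cannot occur after move $k'^{j'}$, i.e. in no firing sequence from $c$ to completion does $k^j$ occur after $k'^{j'}$. *)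

(* Defs.v *)
From Stdlib Require Import Relation_Definitions.
From mathcomp Require Import all_boot finmap.
From mathcomp Require Import boolp classical_sets cardinality.

Set Implicit Arguments.
Unset Strict Implicit.
Unset Printing Implicit Defensive.

Local Open Scope classical_set_scope.
Local Open Scope nat_scope.

(* Graphs may be infinite, and vertices may have infinitely many neighbors. *)
Record sgraph := SGraph {
  vertex :> choiceType;
  adj : rel vertex;
  adj_sym : symmetric adj;
  adj_irr : irreflexive adj }.

Section ChipFiring.
Variable G : sgraph.

Definition config := G -> nat.
Implicit Types (c x y : config) (k v w : G) (s t : seq G).

Definition neighbors v : set G := [set w | adj v w].

(* Only meaningful when [neighbors v] is finite ([fset_set] is empty on
   infinite sets); [can_fire] guards every use. *)
Definition degree v : nat := #|` fset_set (neighbors v)|.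

Definition can_fire c v : Prop := finite_set (neighbors v) /\ degree v <= c v.

Definition fire c v : config :=
  fun w => if w == v then c v - degree v else c w + adj v w.

Fixpoint legal c s : Prop :=
  if s is v :: s' then can_fire c v /\ legal (fire c v) s' else True.

Definition run c s : config := foldl fire c s.

Definition reachable c x : Prop := exists2 s, legal c s & run c s = x.

Definition stable c : Prop := forall v, ~ can_fire c v.

Definition to_completion c s : Prop := legal c s /\ stable (run c s).

Definition terminates c : Prop := exists s, to_completion c s.

(* The number N_k of firings of site k in a firing sequence to completion. The
   choice of sequence is irrelevant, see [num_firingsE] below. *)
Definition num_firings c k : nat :=
  xget 0 [set n | exists2 s, to_completion c s & count_mem k s = n].

Definition config_poset c : Type := {x : config | reachable c x}.

Definition config_ge c (x y : config_poset c) : Prop :=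
  reachable (sval x) (sval y).

(* The pair (k, j) is the move k^j. *)
Definition move_poset c : Type :=
  {m : G * nat | 1 <= m.2 <= num_firings c m.1}.

(* The i-th step of s (counting from 0) is the j-th firing of k. *)
Definition occurs_at s (m : G * nat) (i : nat) : Prop :=
  onth s i = Some m.1 /\ count_mem m.1 (take i.+1 s) = m.2.

Definition occurs_after s (m m' : G * nat) : Prop :=
  exists i i', [/\ occurs_at s m i, occurs_at s m' i' & i' < i].

Definition move_ge c (m m' : move_poset c) : Prop :=
  ~ exists2 s, to_completion c s & occurs_after s (sval m) (sval m').

End ChipFiring.

Arguments config_ge {G} c x y.
Arguments move_ge {G} c m m'.

Section Posets.
Variables (T : Type) (ge : relation T).

Definition covers (x y : T) : Prop :=
  [/\ ge x y, x <> y & forall z, ge x z -> ge z y -> z = x \/ z = y].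

Definition join_irreducible (x : T) : Prop := exists! y, covers x y.

Definition join_irreducibles : Type := {x : T | join_irreducible x}.

Definition ji_ge (x y : join_irreducibles) : Prop := ge (sval x) (sval y).

End Posets.

Arguments ji_ge {T} ge x y.

Definition poset_isomorphic (A B : Type) (geA : relation A) (geB : relation B)
    : Prop :=
  [/\ Relation_Definitions.order A geA, Relation_Definitions.order B geB &
      exists2 f : A -> B, bijective f &
        forall x y, geA x y <-> geB (f x) (f y)].

Section NumFirings.
Variable G : sgraph.
Implicit Types (c x y : config G) (k v w : G) (s t : seq G).

Lemma fireC c v w : can_fire c v -> can_fire c w -> v <> w ->
  fire (fire c v) w = fire (fire c w) v.
Proof.
move=> [_ cv] [_ cw] /eqP vw; apply: funext => u; rewrite /fire.
have wv : (w == v) = false by rewrite eq_sym (negbTE vw).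
have [->|uw] := eqVneq u w; first by rewrite wv addnBAC.
by have [->|_] := eqVneq u v; rewrite ?(negbTE vw) ?addnBAC// addnAC.
Qed.

Lemma can_fire_fire c v w : v <> w -> can_fire c w -> can_fire (fire c v) w.
Proof.
move=> /eqP vw [fw cw]; split=> //.
by rewrite /fire eq_sym (negbTE vw) (leq_trans cw)// leq_addr.
Qed.

Lemma can_fire_run c v s : v \notin s -> can_fire c v -> can_fire (run c s) v.
Proof.
elim: s c => //= w s IHs c; rewrite inE negb_or => /andP[/eqP vw vs] cv.
by apply: IHs => //; apply: can_fire_fire => //; apply: nesym.
Qed.

Lemma legal_to_front c v s t : can_fire c v -> v \notin s ->
  legal c (s ++ v :: t) ->
  legal (fire c v) (s ++ t) /\ run (fire c v) (s ++ t) = run c (s ++ v :: t).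
Proof.
elim: s c => [|w s IHs] c cv; first by move=> _ [].
rewrite inE negb_or => /andP[/eqP vw vs] /= [cw lws].
have cwv : can_fire (fire c w) v by apply: can_fire_fire => //; apply: nesym.
have [l r] := IHs _ cwv vs lws.
by rewrite fireC//; split=> //; split=> //; apply: can_fire_fire.
Qed.

Lemma legal_count_le c s t : legal c s -> to_completion c t ->
  forall k, count_mem k s <= count_mem k t.
Proof.
elim: s c t => // v s IHs c t [cv ls] [lt st] k.
have vt : v \in t.
  by apply: contrapT => /negP /can_fire_run /(_ cv); apply: st.
have vt1 : v \notin take (index v t) t by rewrite in_take// ltnn.
move: lt st; rewrite -(cat_take_drop (index v t) t) drop_index//.
move: vt1; move: (take _ t) (drop _ t) => t1 t2 vt1 lt st.
have [l r] := legal_to_front cv vt1 lt.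
rewrite -r in st; have := IHs _ _ ls (conj l st) k.
by rewrite !count_cat /=; rewrite addnCA leq_add2l.
Qed.

Lemma num_firingsE c s k :
  to_completion c s -> num_firings c k = count_mem k s.
Proof.
move=> cs; apply: xget_unique => [|n [t ct <-]]; first by exists s.
by apply/eqP; rewrite eqn_leq !(@legal_count_le c)//; [case: cs|case: ct].
Qed.

End NumFirings.

(* Main.v *)
Require Import Defs.
From Stdlib Require Import Relation_Definitions.
From mathcomp Require Import all_boot.
From mathcomp Require Import boolp.

(** By the exchange property of chip-firing, a reachable configuration is the
same thing as the multiset of sites fired to reach it, and the configuration
poset is the set of these multisets ordered by reverse inclusion
([reachable_runE]): two firing sequences with the same result can be completed
by the same moves, and completions are unique as multisets.

Consequently the configurations covered by [x] are the results of the single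
firings possible in [x], and [x] is join-irreducible exactly when one site only
can fire in it ([join_irreducibleP]).  The isomorphism sends such an [x] to the
move [k^j] that is forced there.

It is a bijection because of a maximality property ([only_move_max]): a
configuration in which [k^j] is the only possible move has the largest firing
multiset among all those that do not yet contain [k^j], since by exchange a
firing sequence not contained in it must have used the one move available
there.  Conversely, delaying [k^j] as long as possible leads to such a
configuration ([only_move_exists]).

Maximality also gives the order.  Let [x] and [x'] be the configurations that
force [m] and [m'].  If [x'] is reachable from [x], then any firing sequence in
which [m] is still to come is contained in the multiset of [x], hence in that
of [x'], so [m'] is still to come as well: [m] cannot occur after [m'].  If [x']
is not reachable from [x], then [m'] has occurred by the time [x] is reached,
and completing from [x] yields a firing sequence with [m] after [m']
([move_orderE]). *)

Set Implicit Arguments.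
Unset Strict Implicit.
Unset Printing Implicit Defensive.

Local Open Scope nat_scope.

(** * Posets in correspondence *)

(** The order axioms for the second relation come from those for the first, and
antisymmetry of the first makes the correspondence injective. *)
Lemma poset_isomorphic_correspondence (A B : Type) (geA : relation A)
    (geB : relation B) (R : A -> B -> Prop) :
    Relation_Definitions.order A geA ->
    (forall a, exists b, R a b) -> (forall b, exists a, R a b) ->
    (forall a b b', R a b -> R a b' -> b = b') ->
    (forall a a' b b', R a b -> R a' b' -> geA a a' <-> geB b b') ->
  poset_isomorphic geA geB.
Proof.
move=> oA totl totr uniqr geE; have [reflA transA antiA] := oA.
have [f Rf] := choice totl; have [g Rg] := choice totr.
have injl a a' b : R a b -> R a' b -> a = a'.
  move=> Rab Ra'b; have bb : geB b b by apply/(geE _ _ _ _ Rab Rab).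
  by apply: antiA; [apply/(geE _ _ _ _ Rab Ra'b)|apply/(geE _ _ _ _ Ra'b Rab)].
have geEg b b' : geA (g b) (g b') <-> geB b b' by apply: geE.
split=> //; last first.
  exists f; last by move=> x y; apply: geE.
  exists g => [a|b]; first exact: injl (Rg _) (Rf _).
  exact: uniqr (Rf _) (Rg _).
split=> [b|b1 b2 b3|b1 b2].
- exact/geEg/reflA.
- by move=> /geEg g12 /geEg g23; apply/geEg/(transA _ _ _ g12 g23).
- move=> /geEg g12 /geEg g21; apply: (uniqr (g b1)) => //.
  by rewrite (antiA _ _ g12 g21).
Qed.

Lemma sig_eq (T : Type) (P : T -> Prop) (x y : {z | P z}) :
  sval x = sval y -> x = y.
Proof.
by case: x y => [x Px] [y Py] /= xy; apply: eq_exist.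
Qed.

(** * Positions of occurrences in a sequence *)

Section Occurrences.
Variable T : eqType.
Implicit Types (s t p q : seq T) (k : T).

Definition mset_le s t := forall k, count_mem k s <= count_mem k t.

Lemma mset_le_size s t : mset_le s t -> size s <= size t.
Proof.
by move=> /count_subseqP[u /size_subseq ut /perm_size ->].
Qed.

End Occurrences.

Section OccursAt.
Variable G : sgraph.
Implicit Types (s p q : seq G) (m : G * nat) (k : G).

Lemma occurs_at_cat p q m i : occurs_at p m i -> occurs_at (p ++ q) m i.
Proof.
case; rewrite /occurs_at => oi ci.
have ip : i < size p by rewrite -onthTE oi.
by rewrite onth_cat ip takel_cat.
Qed.

Lemma occurs_at_size s m i : occurs_at s m i -> i < size s.
Proof. by case=> oi _; rewrite -onthTE oi. Qed.

Lemma occurs_at_exists s m : 0 < m.2 <= count_mem m.1 s ->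
  exists i, occurs_at s m i.
Proof.
case: m => k j /=; elim/last_ind: s => [|s v IHs] /andP[j0].
  by rewrite leqNgt j0.
have [js _|sj] := leqP j (count_mem k s).
  have [|i oi] := IHs; first by rewrite j0.
  by exists i; rewrite -cats1; apply: occurs_at_cat.
rewrite -cats1 count_cat /= addn0 => jsv.
have vk : v = k.
  by apply/eqP; apply: contraLR jsv => /negbTE ->; rewrite addn0 -ltnNge.
rewrite vk eqxx addn1 in jsv *.
exists (size s); split=> /=; first by rewrite onth_cat ltnn subnn.
rewrite take_oversize ?size_cat ?addn1// count_cat /= eqxx addn0 addn1.
by apply/eqP; rewrite eqn_leq sj jsv.
Qed.

(** The prefix [p] is a time at which [m'] has already occurred and [m] has
not; this form refers to counts only and not to positions. *)
Lemma occurs_afterP s m m' : 0 < m'.2 -> m.2 <= count_mem m.1 s ->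
  occurs_after s m m' <->
  exists p q, [/\ s = p ++ q, count_mem m.1 p < m.2 & m'.2 <= count_mem m'.1 p].
Proof.
move=> m'0 ms; split.
  move=> [i [i' [oi [_ <-] i'i]]].
  have si := occurs_at_size oi; case: oi => oi <-.
  exists (take i s), (drop i s); split; first by rewrite cat_take_drop.
    rewrite (take_nth m.1 si) -cats1 count_cat /=.
    by rewrite (onth_nth _ _ _ _ oi) eqxx addn0 addn1.
  rewrite -(subnKC i'i) takeD.
  by rewrite count_cat leq_addr.
move=> [p [q [sE pm m'p]]].
have [i' oi'] : exists i', occurs_at p m' i'.
  by apply: occurs_at_exists; rewrite m'0.
have [i oi] : exists i, occurs_at s m i.
  by apply: occurs_at_exists; rewrite ms (leq_ltn_trans _ pm).
exists i, i'; split=> //; first by rewrite sE; apply: occurs_at_cat.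
apply: leq_trans (occurs_at_size oi') _; rewrite leqNgt; apply/negP => ip.
case: oi => _; rewrite sE takel_cat// => cE.
move: pm; rewrite -cE -{1}(cat_take_drop i.+1 p) count_cat.
by rewrite ltnNge leq_addr.
Qed.

End OccursAt.

(** * Firing sequences as multisets *)

Section FiringSequences.
Variable G : sgraph.
Implicit Types (c x y : config G) (k v w : G) (s t u : seq G).

Lemma run_cat c s t : run c (s ++ t) = run (run c s) t.
Proof. exact: foldl_cat. Qed.

Lemma legal_cat c s t : legal c (s ++ t) <-> legal c s /\ legal (run c s) t.
Proof.
elim: s c => [|v s IHs] c /=; first by tauto.
by rewrite IHs; tauto.
Qed.

Lemma legal_snoc c s v :
  legal c (s ++ [:: v]) <-> legal c s /\ can_fire (run c s) v.
Proof. by rewrite legal_cat /=; tauto. Qed.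

(** The common step of the two inductions below, which compare two firing
sequences by consuming the first move of one of them in both. *)
Lemma legal_pull c s v : can_fire c v -> legal c s -> v \in s ->
  exists s', [/\ perm_eq s (v :: s'), legal (fire c v) s' &
                 run (fire c v) s' = run c s].
Proof.
move=> cv ls vs.
have vs1 : v \notin take (index v s) s by rewrite in_take// ltnn.
move: ls; rewrite -(cat_take_drop (index v s) s) drop_index//.
move: vs1; move: (take _ s) (drop _ s) => s1 s2 vs1 ls.
have [l r] := legal_to_front cv vs1 ls.
exists (s1 ++ s2); split=> //.
by rewrite perm_catC /= perm_cons perm_catC.
Qed.

(** Read [t] from the left, pulling each of its moves to the front of [s].  The
first move of [t] that is missing from what remains of [s] could fire at once,
and it still can after [s], since firing other sites only adds chips to it. *)
Lemma legal_exchange c s t : legal c s -> legal c t -> ~ mset_le t s ->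
  exists2 k, count_mem k s < count_mem k t & can_fire (run c s) k.
Proof.
elim: t c s => [|v t IHt] c s ls /=; first by move=> _ [].
move=> [cv lt] ts; have [vs|vs] := boolP (v \in s); last first.
  exists v; last exact: can_fire_run.
  by rewrite (count_memPn vs) eqxx.
have [s' [/permP ps ls' rs']] := legal_pull cv ls vs.
have [|k kst ck] := IHt _ _ ls' lt.
  by move=> ts'; apply: ts => k; rewrite ps /= leq_add2l.
by rewrite -rs'; exists k => //; rewrite ps /= ltn_add2l.
Qed.

Lemma mset_le_reachable c s t : legal c s -> legal c t -> mset_le s t ->
  reachable (run c s) (run c t).
Proof.
elim: s c t => [|v s IHs] c t /=; first by exists t.
move=> [cv ls] lt st; have vt : v \in t.
  by rewrite -has_pred1 has_count (leq_trans _ (st v))//= eqxx.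
have [t' [/permP pt lt' rt']] := legal_pull cv lt vt.
rewrite -rt'; apply: IHs => // k.
by have := st k; rewrite pt /= leq_add2l.
Qed.

Lemma reachable_fire c x v : reachable c x -> can_fire x v ->
  reachable c (fire x v).
Proof.
move=> [s ls <-] cv; exists (s ++ [:: v]); last by rewrite run_cat.
exact/legal_snoc.
Qed.

Section Terminating.
Variable c : config G.
Hypothesis c_terminates : terminates c.

Lemma legal_completion s : legal c s -> exists u, to_completion c (s ++ u).
Proof.
move=> ls; have [e [le se]] := c_terminates.
have [u lu ru] : reachable (run c s) (run c e).
  exact: mset_le_reachable (legal_count_le ls (conj le se)).
by exists u; split; [apply/legal_cat|rewrite run_cat ru].
Qed.

(** A completion [u] of [s] also completes [t], and any two completions fire each
site equally often; cancel [u]. *)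
Lemma run_eq_mset_le s t : legal c s -> legal c t -> run c s = run c t ->
  mset_le s t.
Proof.
move=> ls lt st k; have [u [/legal_cat[_ lu] su]] := legal_completion ls.
rewrite run_cat st in su; rewrite st in lu.
have tu : to_completion c (t ++ u).
  by split; [apply/legal_cat|rewrite run_cat].
have su' : legal c (s ++ u) by apply/legal_cat; rewrite st.
by have := legal_count_le su' tu k; rewrite !count_cat leq_add2r.
Qed.

Lemma reachable_runE s t : legal c s -> legal c t ->
  reachable (run c s) (run c t) <-> mset_le s t.
Proof.
move=> ls lt; split; last exact: mset_le_reachable.
move=> [u lu]; rewrite -run_cat => ru k.
have lsu : legal c (s ++ u) by apply/legal_cat.
by apply: leq_trans (run_eq_mset_le lsu lt ru k); rewrite count_cat leq_addr.
Qed.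

Lemma reachable_antisym s t : legal c s -> legal c t ->
  reachable (run c s) (run c t) -> reachable (run c t) (run c s) ->
  run c s = run c t.
Proof.
move=> ls lt [u lu ru] /(reachable_runE lt ls)/mset_le_size.
have lsu : legal c (s ++ u) by apply/legal_cat.
rewrite -run_cat in ru.
have /mset_le_size := run_eq_mset_le lsu lt ru; rewrite size_cat => sut ts.
have /size0nil u0 : size u = 0.
  by apply/eqP; rewrite -leqn0 -(leq_add2l (size s)) addn0 (leq_trans sut).
by rewrite -ru u0 cats0.
Qed.

Lemma fire_inj s v w : legal c s ->
  can_fire (run c s) v -> can_fire (run c s) w ->
  reachable (fire (run c s) v) (fire (run c s) w) -> v = w.
Proof.
move=> ls cv cw.
have lv : legal c (s ++ [:: v]) by apply/legal_snoc.
have lw : legal c (s ++ [:: w]) by apply/legal_snoc.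
have fireE k : fire (run c s) k = run c (s ++ [:: k]) by rewrite run_cat.
rewrite !fireE.
move=> /(reachable_runE lv lw)/(_ v); rewrite !count_cat leq_add2l /= !addn0 eqxx.
by case: eqP.
Qed.

(** * Join-irreducible configurations *)

Lemma config_ge_order :
  Relation_Definitions.order (config_poset c) (config_ge c).
Proof.
split=> [x|x y z|x y]; first by exists [::].
  move=> [s ls rs] [t lt rt]; exists (s ++ t); last by rewrite run_cat rs.
  by apply/legal_cat; rewrite rs.
case: x y => [x xP] [y yP]; rewrite /config_ge /= => xy yx.
apply: sig_eq => /=; case: xP yP xy yx => s ls <- [t lt <-].
exact: reachable_antisym.
Qed.

(** The first move of any nonempty firing sequence from [x] already reaches an
element covered by [x]; it is distinct from [x] because its firing multiset is
larger. *)
Lemma coversP (x y : config_poset c) : covers (config_ge c) x y <->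
  exists2 v, can_fire (sval x) v & sval y = fire (sval x) v.
Proof.
have [refl_ge trans_ge anti_ge] := config_ge_order.
case: (svalP x) => s ls xE.
have fire_neq v z : can_fire (sval x) v -> sval z = fire (sval x) v -> z <> x.
  move=> cv zE zx; rewrite zx -xE in zE cv.
  have lv : legal c (s ++ [:: v]) by apply/legal_snoc.
  have := @run_eq_mset_le (s ++ [:: v]) s lv ls.
  rewrite run_cat /= -zE => /(_ erefl)/mset_le_size.
  by rewrite size_cat addn1 ltnn.
split=> [[[u lu xy] neq_xy between]|[v cv yE]].
  case: u lu xy => [|v u] /=; first by move=> _ /sig_eq.
  move=> [cv lu] uy; exists v => //.
  pose z : config_poset c := exist _ _ (reachable_fire (svalP x) cv).
  case: (between z) => [||/(fire_neq v z cv erefl)//|<- //].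
    by exists [:: v].
  by exists u.
split.
- by exists [:: v]; rewrite ?yE.
- by move=> /esym; apply: fire_neq yE.
move=> z [[|w u] /= lu xz] zy; first by left; apply/esym/sig_eq.
case: lu => cw lu; right.
have wz : reachable (fire (sval x) w) (sval z) by exists u.
have wv : w = v.
  apply: (@fire_inj s) => //; rewrite xE// -yE.
  pose z' : config_poset c := exist _ _ (reachable_fire (svalP x) cw).
  exact: (trans_ge z' z y).
by apply: anti_ge => //; rewrite /config_ge yE -wv.
Qed.

Lemma join_irreducibleP (x : config_poset c) :
  join_irreducible (config_ge c) x <-> exists! v, can_fire (sval x) v.
Proof.
case: (svalP x) => s ls xE.
split=> [[y [/coversP[v cv yE] uniq_y]]|[v [cv uniq_v]]].
  exists v; split=> // w cw.
  have xw := reachable_fire (svalP x) cw.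
  have yw : y = exist _ _ xw by apply/uniq_y/coversP; exists w.
  apply: (@fire_inj s) => //; rewrite xE// -yE yw /=.
  by exists [::].
exists (exist _ _ (reachable_fire (svalP x) cv)); split.
  by apply/coversP; exists v.
move=> y /coversP[w cw yE]; apply: sig_eq; rewrite yE /=.
by rewrite (uniq_v w cw).
Qed.

(** * Forced moves *)

(** Encodes that [run c s] is the join-irreducible configuration corresponding to
the move [m].  A firing sequence is used rather than a configuration because
the index of [m] is read off from the number of firings so far. *)
Definition only_move s (m : G * nat) : Prop :=
  [/\ legal c s, (count_mem m.1 s).+1 = m.2 &
      forall v, can_fire (run c s) v <-> v = m.1].

Lemma only_move_max s m t : only_move s m -> legal c t ->
  count_mem m.1 t < m.2 <-> mset_le t s.
Proof.
move=> [ls <- only_m] lt; split=> [tm|ts]; last exact: ts.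
apply: contrapT => /(legal_exchange ls lt)[k sk /only_m km].
by move: sk; rewrite km ltnNge -ltnS tm.
Qed.

(** A longest firing sequence that has not yet performed [m] has this property:
only [m] can extend it, and something can, since a completion performs [m]. *)
Lemma only_move_exists m : 0 < m.2 <= num_firings c m.1 ->
  exists s, only_move s m.
Proof.
move=> /andP[m0 mN]; have [e [le se]] := c_terminates.
rewrite (num_firingsE _ (conj le se)) in mN.
pose P n := `[< exists s, [/\ legal c s, count_mem m.1 s < m.2 & size s = n] >].
have exP : exists n, P n by exists 0; apply/asboolP; exists [::].
have bound n : P n -> n <= size e.
  move=> /asboolP[s [ls _ <-]]; apply: mset_le_size.
  exact: legal_count_le ls (conj le se).
case: (ex_maxnP exP bound) => n /asboolP[s [ls sm sn]] maxn.
have fires v : can_fire (run c s) v -> v = m.1 /\ m.2 <= (count_mem m.1 s).+1.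
  move=> cv; have: ~~ (count_mem m.1 (s ++ [:: v]) < m.2).
    apply/negP => svm; have: P n.+1.
      apply/asboolP; exists (s ++ [:: v]).
      by split=> //; [apply/legal_snoc|rewrite size_cat addn1 sn].
    by move=> /maxn; rewrite ltnn.
  rewrite -leqNgt count_cat /= addn0; case: eqP => [->|_]; rewrite ?addn1//.
  by rewrite addn0 leqNgt sm.
have [k _ ck] : exists2 k, count_mem k s < count_mem k e & can_fire (run c s) k.
  by apply: legal_exchange => // /(_ m.1); rewrite leqNgt (leq_trans sm).
have [km mS] := fires k ck; exists s; split=> //.
  by apply/eqP; rewrite eqn_leq sm mS.
by move=> v; split=> [/fires[]//|->]; rewrite -km.
Qed.

Lemma only_move_num_firings s m : only_move s m ->
  0 < m.2 <= num_firings c m.1.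
Proof.
move=> [ls <- only_m]; have [e ce] := c_terminates.
have lm : legal c (s ++ [:: m.1]) by apply/legal_snoc; split=> //; apply/only_m.
rewrite (num_firingsE _ ce) /=.
by have := legal_count_le lm ce m.1; rewrite count_cat /= eqxx addn0 addn1.
Qed.

(** A prefix in which [m] is still to come lies below [s], so if [s] lies below
[s'] it cannot contain [m'].  Otherwise [s] contains [m'], and every completion
of [s] performs [m] afterwards. *)
Lemma move_orderE s s' m m' : only_move s m -> only_move s' m' ->
  mset_le s s' <-> ~ exists2 e, to_completion c e & occurs_after e m m'.
Proof.
move=> sm s'm'; have [ls msS _] := sm.
have /andP[_ mN] := only_move_num_firings sm.
have /andP[m'0 _] := only_move_num_firings s'm'.
have afterP e : to_completion c e -> occurs_after e m m' <-> exists p q,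
    [/\ e = p ++ q, count_mem m.1 p < m.2 & m'.2 <= count_mem m'.1 p].
  by move=> ce; apply: occurs_afterP => //; rewrite -(num_firingsE _ ce).
split=> [ss' [e ce /(afterP e ce)[p [q [eE pm m'p]]]]|not_after].
  have lp : legal c p by case: ce; rewrite eE => /legal_cat[].
  have ps : mset_le p s by apply/(only_move_max sm lp).
  have ps' : mset_le p s' by move=> k; apply: leq_trans (ss' k).
  by move/(only_move_max s'm' lp): ps'; rewrite ltnNge m'p.
apply/(only_move_max s'm' ls); rewrite ltnNge; apply/negP => m's.
have [u cu] := legal_completion ls.
apply: not_after; exists (s ++ u) => //; apply/afterP => //.
by exists s, u; rewrite -msS.
Qed.

End Terminating.

End FiringSequences.

Theorem theorem1p1 (G : sgraph) (c : config G) (c_terminates : terminates c) :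
  poset_isomorphic (ji_ge (config_ge c)) (move_ge c).
Proof.
pose forces (x : join_irreducibles (config_ge c)) (m : move_poset c) :=
  exists2 s, run c s = sval (sval x) & only_move c s (sval m).
apply: (@poset_isomorphic_correspondence _ _ _ _ forces).
- have [reflC transC antiC] := config_ge_order c_terminates.
  split=> [x|x y z|x y xy yx]; [exact: reflC|exact: transC|].
  exact/sig_eq/antiC.
- move=> x; have [v [cv uniq_v]] :=
    (join_irreducibleP c_terminates _).1 (svalP x).
  have [s ls xE] := svalP (sval x).
  have sm : only_move c s (v, (count_mem v s).+1).
    split=> // w; rewrite xE; split=> [/uniq_v //|-> //].
  exists (exist (fun m => is_true (0 < m.2 <= num_firings c m.1)) _
                (only_move_num_firings c_terminates sm)).
  by exists s.
- move=> m; have [s sm] := only_move_exists c_terminates (svalP m).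
  have [ls _ only_m] := sm.
  have xP : reachable c (run c s) by exists s.
  have xJ : join_irreducible (config_ge c) (exist _ _ xP).
    apply/(join_irreducibleP c_terminates); exists (sval m).1.
    by split=> [|v /only_m //]; apply/only_m.
  by exists (exist _ _ xJ), s.
- move=> x [m mP] [m' mP'] [s sE [ls msS only_m]] [s' s'E [ls' m'sS only_m']].
  apply: sig_eq; rewrite /= in msS only_m m'sS only_m' *.
  have mm' : m.1 = m'.1 by apply/only_m'; rewrite s'E -sE; apply/only_m.
  have ss' : run c s = run c s' by rewrite sE.
  apply: (etrans (surjective_pairing m)); rewrite [RHS]surjective_pairing -mm'.
  congr pair; rewrite -msS -m'sS -mm'; congr S.
  by apply/eqP; rewrite eqn_leq !(run_eq_mset_le c_terminates).
- move=> x x' m m' [s sE sm] [s' s'E s'm'].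
  rewrite /ji_ge /config_ge -sE -s'E.
  case: (sm) (s'm') => [ls _ _] [ls' _ _].
  rewrite (reachable_runE c_terminates ls ls').
  exact: move_orderE.
Qed.
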